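(* Let $P,Q$ be probability measures on a measurable space $(\Omega,\Sigma)$ with densities $p,q$ with respect to a dominating measure $\lambda$. Consider the family of bounds for the Neyman-Pearson region of $(P,Q)$ $$\beta\ge-\gamma\alpha+1-D_{f_\gamma}(P\|Q),\qquad \gamma\ge 0.\qquad( * )$$ For each $\gamma\ge0$ there exists a likelihood ratio test whose corresponding false positive rate and false negative rate $(\alpha,\beta)$ make equality hold in $( * )$. Varying $\gamma$ in $[0,+\infty)$, the family of straight lines $\beta=-\gamma\alpha+1-D_{f_\gamma}(P\|Q)$ is the family of supporting lines to the Neyman-Pearson boundary of $(P,Q)$.
   Context: Hockey-stick divergence: for $\gamma\ge0$, $f_\gamma(t)=\max\{t-\gamma,0\}$ and $D_{f_\gamma}(P\|Q)=\int\max\{p-\gamma q,0\}\,d\lambda$. Tests: the hypotheses are $H_0$: $x$ is a sample from $Q$, and $H_1$: $x$ is a sample from $P$. A (possibly randomized) test is a measurable $\phi:\Omega\to[0,1]$, accepting $H_0$ with probability $\phi(x)$ and $H_1$ with probability $1-\phi(x)$; its false positive rate is $\alpha=\int(1-\phi)\,dQ$ and its false negative rate is $\beta=\int\phi\,dP$. A nonrandomized test is given by $E\in\Sigma$ ($H_1$ accepted iff $x\in E$), with $\alpha=Q(E)$, $\beta=P(E^c)$. A likelihood ratio test accepts $H_1$ when $p(x)/q(x)$ exceeds a threshold and $H_0$ when it is below the threshold (with $p/q=+\infty$ where $q=0<p$). The Neyman-Pearson region is the set of all $(\alpha,\beta)$ attained by tests; the Neyman-Pearson boundary is its lower boundary,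 the graph of $B(\alpha)=\min\{\beta:(\alpha,\beta)\text{ in the region}\}$ on $[0,1]$. A supporting line to it is a line that lies below (or on) the boundary and meets it in at least one point.
   Formalization: The family is shown to equal the supporting lines of nonpositive slope: as stated the claim fails, since any line of positive slope through (1,0), such as β = α − 1, also lies below the boundary and meets it at (1,0), but is not in the family. *)

(* Defs.v *)
From HB Require Import structures.
From mathcomp Require Import all_boot all_order all_algebra.
From mathcomp Require Import all_classical all_reals all_analysis.
Set Implicit Arguments.
Unset Strict Implicit.
Unset Printing Implicit Defensive.
Import Order.TTheory GRing.Theory Num.Theory.
Local Open Scope classical_set_scope.
Local Open Scope ring_scope.

Section NeymanPearson.
Context {d : measure_display} {T : measurableType d} {R : realType}.

(* [p] is a density of [P] with respect to [lambda]; in particular [lambda]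
   dominates [P].  The measure [lambda] need not be sigma-finite. *)
Definition is_density (lambda : {measure set T -> \bar R})
    (P : probability T R) (p : T -> R) : Prop :=
  [/\ measurable_fun setT p, forall x, 0 <= p x &
      forall A, measurable A -> P A = (\int[lambda]_(x in A) (p x)%:E)%E].

(* D_{f_g}(P || Q) for f_g(t) = max(t - g, 0), in terms of the densities. *)
Definition hockey_stick (lambda : {measure set T -> \bar R})
    (p q : T -> R) (g : R) : R :=
  \int[lambda]_x Num.max (p x - g * q x) 0.

(* [phi x] is the probability of accepting H0 (the sample is from Q). *)
Definition is_test (phi : T -> R) : Prop :=
  measurable_fun setT phi /\ forall x, 0 <= phi x <= 1.

Definition false_positive (Q : probability T R) (phi : T -> R) : R :=
  \int[Q]_x (1 - phi x).

Definition false_negative (P : probability T R) (phi : T -> R) : R :=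
  \int[P]_x phi x.

(* Only used where [p x] and [q x] are not both zero. *)
Definition likelihood_ratio (p q : T -> R) (x : T) : \bar R :=
  if q x == 0 then +oo%E else (p x / q x)%:E.

(* The test is unconstrained (possibly randomized) where the ratio equals the
   threshold, and where the ratio is the undefined 0/0. *)
Definition is_likelihood_ratio_test (p q phi : T -> R) : Prop :=
  is_test phi /\
  exists t : R, forall x, ~ (p x = 0 /\ q x = 0) ->
    ((t%:E < likelihood_ratio p q x)%E -> phi x = 0) /\
    ((likelihood_ratio p q x < t%:E)%E -> phi x = 1).

Definition np_region (P Q : probability T R) : set (R * R) :=
  [set z | exists2 phi, is_test phi &
           z = (false_positive Q phi, false_negative P phi)].

(* The graph of B(alpha) = min {beta | (alpha, beta) in the region}. *)
Definition np_boundary (P Q : probability T R) : set (R * R) :=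
  [set z | np_region P Q z /\
           forall beta, np_region P Q (z.1, beta) -> z.2 <= beta].

Definition np_line (lambda : {measure set T -> \bar R})
    (p q : T -> R) (g : R) : set (R * R) :=
  [set z | z.2 = - g * z.1 + 1 - hockey_stick lambda p q g].

End NeymanPearson.

Section Lines.
Context {R : realType}.

Definition is_line (L : set (R * R)) : Prop :=
  exists a b c : R, (a, b) <> (0, 0) /\ L = [set z | a * z.1 + b * z.2 = c].

(* A vertical line meeting [C] does not lie below [C]. *)
Definition supporting_line (C L : set (R * R)) : Prop :=
  [/\ is_line L,
      forall z w, C z -> L w -> w.1 = z.1 -> w.2 <= z.2 &
      C `&` L !=set0].

(* Excludes the lines of positive slope through (1, 0), which lie below any
   Neyman-Pearson boundary and meet it at its right end point only. *)
Definition nonincreasing_line (L : set (R * R)) : Prop :=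
  forall z w, L z -> L w -> z.1 < w.1 -> w.2 <= z.2.

End Lines.

(* Main.v *)
Require Import Defs.
From HB Require Import structures.
From mathcomp Require Import all_boot all_order all_algebra.
From mathcomp Require Import all_classical all_reals all_analysis.
From mathcomp Require Import measurable_realfun ring lra.
Import Order.TTheory GRing.Theory Num.Theory.
Local Open Scope classical_set_scope.
Local Open Scope ring_scope.

(** Write psi = 1 - phi for the probability with which a test phi accepts H1.
    Since P and Q have densities, alpha is the integral of [psi * q] and beta is
    1 minus the integral of [psi * p], so

      beta + g * alpha = 1 - (integral over lambda of psi * (p - g * q)).

    As 0 <= psi <= 1, the integrand is at most max(p - g * q, 0), whose integral
    is the hockey-stick divergence; this is the family of bounds.  The maximum is
    attained pointwise by psi = 1 on the set where p > g * q and psi = 0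
    elsewhere, which is the likelihood ratio test with threshold g; so each line
    of the family touches the region ([np_bound], [hockey_stick_attained]).

    A point of the region on a line of the family lies on the boundary, because
    the line bounds the region from below; so every line of the family is a
    supporting line ([np_line_supporting]).  Conversely a supporting line cannot
    be vertical, hence is the graph of [fun alpha => - g * alpha + k], and 0 <= g
    when the line is nonincreasing.  Among parallel non-vertical lines at most one
    supports a given set, and the line of slope [- g] in the family is one that
    does; hence k = 1 - D_{f_g}(P || Q) ([parallel_supporting_lines]). *)

(** * Integration against a measure given by a density *)

Section Density.
Context {d : measure_display} {T : measurableType d} {R : realType}.
Variables (lambda : {measure set T -> \bar R}) (P : probability T R).
Variable p : T -> R.
Hypothesis hp : is_density lambda P p.

Let mp : measurable_fun setT p. Proof. by case: hp. Qed.
Let p_ge0 x : 0 <= p x. Proof. by case: hp. Qed.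
Let densityE A : measurable A -> P A = (\int[lambda]_(x in A) (p x)%:E)%E.
Proof. by case: hp => _ _; exact. Qed.

Import HBNNSimple.

Local Open Scope ereal_scope.

Lemma integral_density_nnsfun (h : {nnsfun T >-> R}) :
  \int[P]_x (h x)%:E = \int[lambda]_x ((h x)%:E * (p x)%:E).
Proof.
have mpre r : measurable (h @^-1` [set r]) by exact: measurable_funPTI.
rewrite integralT_nnsfun sintegralE.
transitivity (\int[lambda]_x
    \sum_(r \in range h) (r%:E * (\1_(h @^-1` [set r]) x * p x)%:E)).
  have mg r : measurable_fun setT (fun x => (\1_(h @^-1` [set r]) x * p x)%:E).
    by apply/measurable_EFinP; exact: measurable_funM.
  have g_ge0 r x : 0 <= r%:E * (\1_(h @^-1` [set r]) x * p x)%:E.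
    by rewrite EFinM muleA; apply: mule_ge0;
      [rewrite -EFinM; exact: nnfun_muleindic_ge0|rewrite lee_fin].
  rewrite ge0_integral_fsum//; last first.
    by move=> r; apply: measurable_funeM.
  apply: eq_fsbigr => r; rewrite inE => -[x _ <-].
  rewrite ge0_integralZl//; last 2 first.
  - by move=> y _; rewrite lee_fin mulr_ge0.
  - by rewrite lee_fin.
  congr (_ * _); rewrite [LHS]densityE// [LHS]integral_mkcond.
  apply: eq_integral => y _.
  by rewrite patchE indicE; case: ifP; rewrite ?mul1r ?mul0r.
apply: eq_integral => x _; rewrite [in RHS]fimfunE -fsumEFin//.
rewrite ge0_mule_fsuml; last by move=> r; exact: nnfun_muleindic_ge0.
by apply: eq_fsbigr => r _; rewrite !EFinM muleA.
Qed.

(** The density formula for sets extends to simple functions by linearity, then to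
    all nonnegative functions by monotone convergence.  As [lambda] may fail to be
    sigma-finite, the Radon-Nikodym change of variables does not apply. *)
Lemma ge0_integral_density (f : T -> \bar R) :
    measurable_fun setT f -> (forall x, 0 <= f x) ->
  \int[P]_x f x = \int[lambda]_x (f x * (p x)%:E).
Proof.
move=> mf f_ge0; pose h := nnsfun_approx measurableT mf.
have h_cvg x : (h n x)%:E @[n --> \oo] --> f x by exact: cvg_nnsfun_approx.
have h_nd x : {homo (fun n => (h n x)%:E) : m n / (m <= n)%O >-> m <= n}.
  by move=> m n mn; rewrite lee_fin; exact/lefP/nd_nnsfun_approx.
have mh n : measurable_fun setT (fun x => (h n x)%:E) by exact/measurable_EFinP.
transitivity (limn (fun n => \int[P]_x (h n x)%:E)).
  rewrite -monotone_convergence//.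
  - by apply: eq_integral => x _; apply/esym/cvg_lim.
  - by move=> n x _; rewrite lee_fin.
under eq_fun do rewrite integral_density_nnsfun.
rewrite -monotone_convergence//.
- by apply: eq_integral => x _; apply/cvg_lim => //; exact: cvgeZr.
- by move=> n; apply: emeasurable_funM => //; exact/measurable_EFinP.
- by move=> n x _; rewrite -EFinM lee_fin mulr_ge0.
- by move=> x _ m n mn; rewrite lee_wpmul2r ?lee_fin//; exact: h_nd.
Qed.

Lemma integrable_density : lambda.-integrable setT (EFin \o p).
Proof.
apply/integrableP; split; first exact/measurable_EFinP.
under eq_integral => x _ do rewrite gee0_abs ?lee_fin//.
by rewrite -densityE// probability_setT ltry.
Qed.

Local Close Scope ereal_scope.

Lemma Rintegral_density1 : \int[lambda]_x p x = 1.
Proof. by rewrite /Rintegral -densityE// probability_setT. Qed.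

Lemma integrable_test_density (psi : T -> R) : is_test psi ->
  lambda.-integrable setT (EFin \o (fun x => psi x * p x)).
Proof.
move=> [mpsi psi01]; apply: le_integrable integrable_density => //.
  by apply/measurable_EFinP; exact: measurable_funM.
move=> x _ /=; have /andP[psi0 psi1] := psi01 x.
by rewrite lee_fin normrM (ger0_norm psi0) ler_piMl.
Qed.

Lemma Rintegral_test_density (psi : T -> R) : is_test psi ->
  \int[P]_x psi x = \int[lambda]_x (psi x * p x).
Proof.
move=> [mpsi psi01]; rewrite /Rintegral ge0_integral_density//.
- exact/measurable_EFinP.
- by move=> x; rewrite lee_fin; case/andP: (psi01 x).
Qed.

End Density.
Arguments integrable_density {d T R lambda P p}.
Arguments Rintegral_density1 {d T R lambda P p}.
Arguments integrable_test_density {d T R lambda P p} hp {psi}.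
Arguments Rintegral_test_density {d T R lambda P p} hp {psi}.

(** * The hockey-stick bounds and the tests that attain them *)

Section HockeyStick.
Context {d : measure_display} {T : measurableType d} {R : realType}.
Variables (lambda : {measure set T -> \bar R}) (P Q : probability T R).
Variables p q : T -> R.
Hypothesis hp : is_density lambda P p.
Hypothesis hq : is_density lambda Q q.

Let mp : measurable_fun setT p. Proof. by case: hp. Qed.
Let mq : measurable_fun setT q. Proof. by case: hq. Qed.
Let p_ge0 x : 0 <= p x. Proof. by case: hp. Qed.
Let q_ge0 x : 0 <= q x. Proof. by case: hq. Qed.

Lemma is_test_onem (phi : T -> R) : is_test phi -> is_test (fun x => 1 - phi x).
Proof.
move=> [mphi phi01]; split; first exact: measurable_funB.
by move=> x; have /andP[phi0 phi1] := phi01 x; apply/andP; split; lra.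
Qed.

Let integrable_weighted (g : R) (psi : T -> R) : is_test psi ->
  lambda.-integrable setT (EFin \o (fun x => g * (psi x * q x))).
Proof.
move=> tpsi; have /(integrableZl measurableT g) := integrable_test_density hq tpsi.
by apply: eq_integrable.
Qed.

Let integrable_gain (g : R) (psi : T -> R) : is_test psi ->
  lambda.-integrable setT (EFin \o (fun x => psi x * p x - g * (psi x * q x))).
Proof.
move=> tpsi.
have := integrableB measurableT (integrable_test_density hp tpsi)
  (integrable_weighted g _ tpsi).
by apply: eq_integrable.
Qed.

(** The weighted error of a test is 1 minus an integral which is linear in the
    probability of accepting H1, so that it can be optimized pointwise. *)
Lemma weighted_errorE (g : R) (phi : T -> R) : is_test phi ->
  false_negative P phi + g * false_positive Q phi =
  1 - \int[lambda]_x ((1 - phi x) * p x - g * ((1 - phi x) * q x)).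
Proof.
move=> tphi; have tpsi := is_test_onem _ tphi.
have ipsip := integrable_test_density hp tpsi.
rewrite /false_negative /false_positive.
rewrite (Rintegral_test_density hq tpsi) (Rintegral_test_density hp tphi).
have -> : \int[lambda]_x (phi x * p x) = 1 - \int[lambda]_x ((1 - phi x) * p x).
  (* Only the outer 1 stands for the total mass of [P]. *)
  rewrite -{1}(Rintegral_density1 hp) -RintegralB//; last exact: (integrable_density hp).
  by apply: eq_Rintegral => x _; ring.
rewrite RintegralB//; last exact: integrable_weighted.
rewrite RintegralZl//; last exact: (integrable_test_density hq tpsi).
by ring.
Qed.

Let integrable_hockey_stick (g : R) :
  lambda.-integrable setT (EFin \o (fun x => Num.max (p x - g * q x) 0)).
Proof.
have t1 : is_test (fun _ : T => 1 : R) by split=> // x; rewrite ler01 lexx.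
have := integrable_gain g _ t1; apply: le_integrable => //.
  apply/measurable_EFinP; apply: measurable_maxr => //.
  by apply: measurable_funB => //; exact: measurable_funM.
move=> x _ /=; rewrite lee_fin !mul1r ger0_norm ?le_max ?lexx ?orbT//.
by rewrite ge_max ler_norm normr_ge0.
Qed.

Lemma np_bound (g alpha beta : R) : np_region P Q (alpha, beta) ->
  - g * alpha + 1 - hockey_stick lambda p q g <= beta.
Proof.
move=> [phi tphi [-> ->]].
suff : \int[lambda]_x ((1 - phi x) * p x - g * ((1 - phi x) * q x)) <=
    hockey_stick lambda p q g.
  by move: (weighted_errorE g _ tphi); lra.
apply: le_Rintegral => //; first exact: integrable_gain (is_test_onem _ tphi).
move=> x _; have [_ /(_ x) /andP[psi0 psi1]] := is_test_onem _ tphi.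
rewrite mulrCA -mulrBr; apply: le_trans (_ : _ <= (1 - phi x) * Num.max (p x - g * q x) 0) _.
  by rewrite ler_wpM2l// le_max lexx.
by rewrite ler_piMl// le_max lexx orbT.
Qed.

Lemma hockey_stick_attained (g : R) : 0 <= g -> exists phi : T -> R,
  is_likelihood_ratio_test p q phi /\
  false_negative P phi = - g * false_positive Q phi + 1 - hockey_stick lambda p q g.
Proof.
move=> g0; pose phi x : R := if p x < g * q x then 1 else 0.
have tphi : is_test phi.
  split; last by move=> x; rewrite /phi; case: ifP; rewrite ?ler01 ?lexx.
  apply: measurable_fun_ifT => //; apply: measurable_fun_ltr => //.
  exact: measurable_funM.
exists phi; split.
  split=> //; exists g => x pq0; rewrite /likelihood_ratio /phi.
  case: eqP => [qx0|/eqP qx0].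
    (* The ratio is infinite here, and p < g * q fails for every g. *)
    by split=> // _; rewrite qx0 mulr0 ltNge p_ge0.
  have qx_gt0 : 0 < q x by rewrite lt_def qx0 q_ge0.
  rewrite !lte_fin ltr_pdivlMr// ltr_pdivrMr//; split=> [gq|->//].
  by rewrite ltNge (ltW gq).
have -> : hockey_stick lambda p q g =
    \int[lambda]_x ((1 - phi x) * p x - g * ((1 - phi x) * q x)).
  apply: eq_Rintegral => x _; rewrite /phi; case: ltP => [pq|qp].
    by rewrite max_r; lra.
  by rewrite max_l; lra.
by move: (weighted_errorE g _ tphi); lra.
Qed.

(** * Supporting lines of the boundary *)

(** A point of the region on a line of the family is the lowest point of the
    region above its abscissa, by the bound at that very slope. *)
Lemma np_line_meets_boundary (g : R) : 0 <= g ->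
  np_boundary P Q `&` np_line lambda p q g !=set0.
Proof.
move=> g0; have [phi [[tphi _] attained]] := hockey_stick_attained _ g0.
exists (false_positive Q phi, false_negative P phi); split=> //.
split; first by exists phi.
by move=> beta /(np_bound g) /=; rewrite attained.
Qed.

Lemma np_line_supporting (g : R) : 0 <= g ->
  supporting_line (np_boundary P Q) (np_line lambda p q g).
Proof.
move=> g0; split; last exact: np_line_meets_boundary.
  exists g, 1, (1 - hockey_stick lambda p q g); split.
    by move=> [_ /eqP]; rewrite oner_eq0.
  by apply/seteqP; split=> -[z1 z2]; rewrite /np_line/=; lra.
by move=> [a b] w [/(np_bound g) zreg _] -> /= ->.
Qed.

Lemma np_line_nonincreasing (g : R) : 0 <= g ->
  nonincreasing_line (np_line lambda p q g).
Proof.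
move=> g0 z w -> -> zw; have := ler_wpM2l g0 (ltW zw); lra.
Qed.

End HockeyStick.

(** A vertical line through a point of [C] contains points above it. *)
Lemma supporting_line_graph {R : realType} (C L : set (R * R)) :
    supporting_line C L -> nonincreasing_line L ->
  exists2 g : R, 0 <= g & exists k : R, L = [set z | z.2 = - g * z.1 + k].
Proof.
move=> [[a [b [c [ab0 ->]]]] below [z [Cz Lz]]] noninc.
have b0 : b != 0.
  apply/eqP => b0; have := below z (z.1, z.2 + 1) Cz.
  rewrite /= b0 !mul0r => /(_ _ erefl); move: Lz; rewrite /= b0 mul0r => Lz.
  by move=> /(_ Lz); lra.
have LE : [set z : R * R | a * z.1 + b * z.2 = c] =
    [set z | z.2 = - (a / b) * z.1 + c / b].
  apply/seteqP; split=> -[x y] /= h.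
    by rewrite -h; field.
  by rewrite h; field.
exists (a / b); last by exists (c / b).
rewrite LE in noninc.
by have := noninc (0, c / b) (1, - (a / b) + c / b); rewrite /=; lra.
Qed.

(** At a point of [C] on one of the two lines the other line is not higher, so each
    intercept is at most the other. *)
Lemma parallel_supporting_lines {R : realType} (C : set (R * R)) (g k l : R) :
    supporting_line C [set z | z.2 = - g * z.1 + k] ->
    supporting_line C [set z | z.2 = - g * z.1 + l] ->
  k = l.
Proof.
move=> [_ kbelow [u [Cu uk]]] [_ lbelow [v [Cv vl]]].
have := kbelow v (v.1, - g * v.1 + k) Cv erefl erefl.
have := lbelow u (u.1, - g * u.1 + l) Cu erefl erefl.
by rewrite /= uk vl; lra.
Qed.

Theorem proposition1 (d : measure_display) (T : measurableType d) (R : realType)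
    (lambda : {measure set T -> \bar R}) (P Q : probability T R) (p q : T -> R)
    (hp : is_density lambda P p) (hq : is_density lambda Q q) :
  [/\ forall g : R, 0 <= g -> forall alpha beta : R,
        np_region P Q (alpha, beta) ->
        - g * alpha + 1 - hockey_stick lambda p q g <= beta,
      forall g : R, 0 <= g -> exists phi : T -> R,
        is_likelihood_ratio_test p q phi /\
        false_negative P phi =
          - g * false_positive Q phi + 1 - hockey_stick lambda p q g &
      [set np_line lambda p q g | g in [set g : R | 0 <= g]] =
      [set L | supporting_line (np_boundary P Q) L /\ nonincreasing_line L]].
Proof.
split.
- by move=> g _ alpha beta; exact: np_bound.
- exact: hockey_stick_attained.
- apply/seteqP; split=> [_ [g g0 <-]|L [supL nonincL]].
    by split; [exact: np_line_supporting|exact: np_line_nonincreasing].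
  have [g g0 [k LE]] := supporting_line_graph _ _ supL nonincL.
  exists g => //; rewrite LE in supL *.
  have npE : np_line lambda p q g =
      [set z | z.2 = - g * z.1 + (1 - hockey_stick lambda p q g)].
    by apply/funext => z; rewrite /np_line/= addrA.
  have := np_line_supporting _ _ _ _ _ hp hq _ g0.
  by rewrite npE => /(parallel_supporting_lines _ _ _ _ supL) ->.
Qed.
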